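(* Let $1\le p\le\infty$. Suppose that $f,g:\mathbb{R}\to\mathbb{R}$ are locally Lipschitz, that there are nonnegative constants $k_1,k_2,c_1,c_2$ with $|g(x)|\le k_1|x|+k_2$ and $|f(x)|\le c_1|x|+c_2$ for all $x\in\mathbb{R}$, that $k_1\beta c_1<1$, and that $g\in C^1(\mathbb{R})$ with $|g'(x)|\le k_3|x|+k_4$ for all $x\in\mathbb{R}$ and some nonnegative constants $k_3,k_4$. Let $\rho>0$ and assume that $|g(x)|<\rho$ for all $x\in\mathbb{R}$, that $g^{-1}$ is continuous in $]-\rho,\rho[$, and that the function $$\theta(m)=-\tfrac12 f(m)^2-hf(m)-\beta^{-1}i(m),\qquad i(m)=-\int_0^{f(m)}g^{-1}(f^{-1}(s))\,ds,\qquad m\in[-\rho,\rho],$$ has a global minimum $\overline m$ in $]-\rho,\rho[$. Then the functional $\mathcal{F}:\{u\in L^p(\Omega):\|u\|_\infty\le\rho\}\to\mathbb{R}$, $$\mathcal{F}(u)=\int_\Omega[\theta(u(x))-\theta(\overline m)]\,dx+\frac14\int_\Omega\int_\Omega J(x,y)[f(u(x))-f(u(y))]^2\,dx\,dy,$$ is continuous in the topology of $L^p(\Omega)$.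
   Context: $\Omega\subset\mathbb{R}^N$ ($N\ge1$) is a bounded smooth domain; $h\ge 0$ and $\beta>0$ are constants. $J:\mathbb{R}^N\times\mathbb{R}^N\to\mathbb{R}$ is a nonnegative symmetric function of class $C^1$ with $\int_{\mathbb{R}^N}J(x,y)\,dy=\int_{\mathbb{R}^N}J(x,y)\,dx=1$. It is implicit in the definition of $\theta$ that the inverse functions $f^{-1}$ and $g^{-1}$ occurring there exist and that $\theta$ is a well-defined real-valued function on $[-\rho,\rho]$ (the integral defining $i(\pm\rho)$ being possibly improper but convergent). *)

(* Defs.v *)
From HB Require Import structures.
From mathcomp Require Import all_boot all_order all_algebra.
From mathcomp Require Import all_classical all_reals all_analysis.
From mathcomp Require Import lra.

Set Implicit Arguments.
Unset Strict Implicit.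
Unset Printing Implicit Defensive.
Import Order.TTheory GRing.Theory Num.Theory.
Import numFieldNormedType.Exports.

Local Open Scope classical_set_scope.
Local Open Scope ring_scope.

(* The sigma-algebra generated by the coordinate functions. It is the Borel one:
   the coordinates are continuous, and conversely open sets are measurable
   ([open_measurable_mx]). *)
Definition mx_display : measure_display.
Proof. exact: default_measure_display. Qed.

Section measurable_matrix.
Variables (R : realType) (m n : nat).

Definition mx_coord (ij : 'I_m * 'I_n) (A : 'M[R]_(m, n)) : measurableTypeR R :=
  A ij.1 ij.2.

Definition mx_measurable : set (set 'M[R]_(m, n)) :=
  <<s \bigcup_ij preimage_set_system setT (mx_coord ij) measurable >>.

Let mx_measurable0 : mx_measurable set0.
Proof. exact: sigma_algebra0. Qed.

Let mx_measurableC A : mx_measurable A -> mx_measurable (~` A).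
Proof. exact: sigma_algebraC. Qed.

Let mx_measurable_bigcup (F : (set 'M[R]_(m, n))^nat) :
  (forall i, mx_measurable (F i)) -> mx_measurable (\bigcup_i F i).
Proof. exact: sigma_algebra_bigcup. Qed.

HB.instance Definition _ := @isMeasurable.Build mx_display 'M[R]_(m, n)
  mx_measurable mx_measurable0 mx_measurableC mx_measurable_bigcup.

End measurable_matrix.


Lemma measurable_mx_coord (R : realType) (m n : nat) (i : 'I_m) (j : 'I_n) :
  measurable_fun [set: 'M[R]_(m, n)] (fun A => A i j : measurableTypeR R).
Proof.
move=> _ Y mY; rewrite setTI; apply: sub_sigma_algebra.
by exists (i, j) => //; exists Y => //; rewrite setTI.
Qed.

Lemma measurable_fun_mx d (T : measurableType d) (R : realType) (m n : nat)
    (f : T -> 'M[R]_(m, n)) :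
  (forall i j, measurable_fun [set: T] (fun x => f x i j : measurableTypeR R)) ->
  measurable_fun [set: T] f.
Proof.
move=> mf; apply: (measurability (\bigcup_ij preimage_set_system setT
  (@mx_coord R m n ij) measurable)) => //.
move=> _ [_ [[i j] _ [Y mY <-]] <-].
by rewrite [X in _ X](_ : _ = setT `&` (fun x => f x i j) @^-1` Y);
  [exact: mf|rewrite setTI].
Qed.

Lemma open_measurable_mx (R : realType) (m n : nat) (A : set 'M[R]_(m, n)) :
  open A -> measurable A.
Proof.
move=> oA.
pose box (q : {ffun 'I_m * 'I_n -> rat * rat}) : set 'M[R]_(m, n) :=
  [set M | forall ij, ratr (q ij).1 < M ij.1 ij.2 < ratr (q ij).2].
have mbox q : measurable (box q).
  rewrite (_ : box q = \bigcap_ij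
      [set M | ratr (q ij).1 < M ij.1 ij.2 < ratr (q ij).2]); last first.
    by apply/seteqP; split => M /= bM ij; [move=> _; exact: bM|exact: bM].
  apply: fin_bigcap_measurable => [|[i j] _ /=]; first exact: finite_finset.
  rewrite [X in measurable X](_ : _ = setT `&` (fun M : 'M[R]_(m, n) => M i j) @^-1`
      `]ratr (q (i, j)).1, ratr (q (i, j)).2[%classic).
    by apply: (@measurable_mx_coord R m n i j measurableT); exact: measurable_itv.
  by apply/seteqP; split => M /=; rewrite in_itv//= => -[].
rewrite (_ : A = \bigcup_q (if `[< box q `<=` A >] then box q else set0)).
  apply: countable_bigcupT_measurable => // q.
  by case: asboolP.
apply/seteqP; split => [M AM|M [q _]]; last first.
  by case: asboolP => // + bM; exact.
have /nbhs_ballP[e e0 eA] : nbhs M A by exact: open_nbhs_nbhs.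
have qP ij : exists q : rat * rat,
    (M ij.1 ij.2 - e < ratr q.1 < M ij.1 ij.2) &&
    (M ij.1 ij.2 < ratr q.2 < M ij.1 ij.2 + e).
  have /rat_in_itvoo[q1] : M ij.1 ij.2 - e < M ij.1 ij.2 by rewrite ltrBlDr ltrDl.
  have /rat_in_itvoo[q2] : M ij.1 ij.2 < M ij.1 ij.2 + e by rewrite ltrDl.
  by rewrite !in_itv/= => q2P q1P; exists (q1, q2) => /=; rewrite q1P q2P.
pose q := [ffun ij => sval (cid (qP ij))].
have qE ij : (M ij.1 ij.2 - e < ratr (q ij).1 < M ij.1 ij.2) &&
    (M ij.1 ij.2 < ratr (q ij).2 < M ij.1 ij.2 + e).
  by rewrite ffunE; case: cid.
exists q => //; case: asboolP => [_|].
  by move=> ij /=; have /andP[/andP[_ ->] /andP[-> _]] := qE ij.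
case=> B bB; apply: eA; split=> // i j; rewrite /ball/= ltr_norml.
have /= /andP[/andP[q1 q2] /andP[q3 q4]] := qE (i, j).
have /= /andP[b1 b2] := bB (i, j).
by lra.
Qed.

(* The Lebesgue measure on R^n, by induction on n: a point mass for n = 0, and
   the image of the product of the Lebesgue measures on R and on R^n under the
   concatenation R * R^n -> R^(1 + n) otherwise. *)
Section lebesgue_measure_rV.
Variable R : realType.

Definition cons_rV (n : nat) (z : measurableTypeR R * 'rV[R]_n) : 'rV[R]_n.+1 :=
  row_mx (z.1)%:M z.2.

Lemma cons_rVE n z (j : 'I_n.+1) :
  @cons_rV n z 0 j = if unlift 0 j is Some k then z.2 0 k else z.1.
Proof.
case: unliftP => [k ->|->].
  have <- := row_mxEr (z.1)%:M z.2 0 k.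
  by congr (row_mx _ _ _ _); exact: val_inj.
have := row_mxEl (z.1)%:M z.2 0 (0 : 'I_1).
rewrite [in X in _ = X -> _]mxE mulr1n => <-.
by congr (row_mx _ _ _ _); exact: val_inj.
Qed.

Lemma measurable_cons_rV n : measurable_fun setT (@cons_rV n).
Proof.
apply: measurable_fun_mx => i j; rewrite ord1.
under eq_fun do rewrite cons_rVE.
case: unliftP => [k _|_]; last exact: measurable_fst.
exact: (measurableT_comp (@measurable_mx_coord R 1 n 0 k) measurable_snd).
Qed.

Definition uncons_rV (n : nat) (v : 'rV[R]_n.+1) : measurableTypeR R * 'rV[R]_n :=
  (v 0 0, col' 0 v).

Lemma cons_rVK n : cancel (@cons_rV n) (@uncons_rV n).
Proof.
case=> x v; rewrite /uncons_rV cons_rVE unlift_none; congr pair.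
by apply/rowP => j; rewrite mxE cons_rVE liftK.
Qed.

Lemma measurable_uncons_rV n : measurable_fun setT (@uncons_rV n).
Proof.
apply/measurable_fun_pairP; split => /=.
  exact: (@measurable_mx_coord R 1 n.+1 0 0).
apply: measurable_fun_mx => i j.
under eq_fun do rewrite mxE.
exact: (@measurable_mx_coord R 1 n.+1 i (lift 0 j)).
Qed.

Section step.
Variables (n : nat) (mu : {sigma_finite_measure set 'rV[R]_n -> \bar R}).

Definition lebesgue_cons : set 'rV[R]_n.+1 -> \bar R :=
  pushforward (@lebesgue_measure R \x mu)%E (@cons_rV n).

Let pushforward_mu : {measure set 'rV[R]_n.+1 -> \bar R} :=
  measure_function_pushforward__canonical__measure_function_Measure
    (@lebesgue_measure R \x mu)%E (@measurable_cons_rV n).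

HB.instance Definition _ := isMeasure.Build _ _ _ lebesgue_cons
  (measure0 pushforward_mu) (measure_ge0 pushforward_mu)
  (@measure_semi_sigma_additive _ _ _ pushforward_mu).

Let lebesgue_cons_sigma_finite : sigma_finite setT lebesgue_cons.
Proof.
have /sigma_finiteP[F [TF ndF Foo]] := sigma_finiteT (@lebesgue_measure R).
have /sigma_finiteP[G [TG ndG Goo]] := sigma_finiteT mu.
exists (fun k => @uncons_rV n @^-1` (F k `*` G k)) => [|k].
  apply/esym/seteqP; split => // v _.
  have [i _ Fi] : (\bigcup_i F i) (uncons_rV v).1 by rewrite -TF.
  have [j _ Gj] : (\bigcup_i G i) (uncons_rV v).2 by rewrite -TG.
  exists (maxn i j) => //; split.
    by move: Fi; exact/subsetPset/ndF/leq_maxl.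
  by move: Gj; exact/subsetPset/ndG/leq_maxr.
have [mF Fk] := Foo k; have [mG Gk] := Goo k; split.
  rewrite -[X in measurable X]setTI.
  by apply: measurable_uncons_rV => //; exact: measurableX.
rewrite /lebesgue_cons /pushforward.
rewrite (_ : _ @^-1` _ = F k `*` G k).
  by rewrite product_measure1E// lte_mul_pinfty// ge0_fin_numE.
by apply/funext => z; rewrite /preimage /mkset cons_rVK.
Qed.

HB.instance Definition _ := Measure_isSigmaFinite.Build _ _ _ lebesgue_cons
  lebesgue_cons_sigma_finite.

End step.

Fixpoint lebesgue_rV (n : nat) : {sigma_finite_measure set 'rV[R]_n -> \bar R} :=
  match n with
  | 0 => dirac (0 : 'rV[R]_0)
  | n'.+1 => lebesgue_cons (lebesgue_rV n')
  end.

Lemma lebesgue_rV_box (n : nat) (A : 'I_n -> set (measurableTypeR R)) :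
  (forall i, measurable (A i)) ->
  lebesgue_rV n [set v | forall i, A i (v 0 i)] =
  \big[*%E/1%E]_(i < n) lebesgue_measure (A i).
Proof.
elim: n A => [|n IHn] A mA.
  by rewrite big_ord0 /= diracE mem_set// => -[].
have mbox : measurable [set v : 'rV[R]_n | forall i, A (lift 0 i) (v 0 i)].
  rewrite [X in measurable X](_ : _ =
      \bigcap_i [set v : 'rV[R]_n | A (lift 0 i) (v 0 i)]); last first.
    by apply/seteqP; split => v /= bv i; [move=> _; exact: bv|exact: bv].
  apply: fin_bigcap_measurable => [|i _]; first exact: finite_finset.
  rewrite -[X in measurable X]setTI.
  by apply: (@measurable_mx_coord R 1 n 0 i measurableT); exact: mA.
rewrite big_ord_recl -(IHn (fun i => A (lift 0 i)))//.
rewrite -product_measure1E//=; congr (product_measure1 _ _ _).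
apply/seteqP; split => -[x v] /= => [bv|[Ax bv] i]; last first.
  by rewrite cons_rVE; case: unliftP => [k ->|->] //=; exact: bv.
split; first by have := bv 0; rewrite cons_rVE unlift_none.
by move=> i; have := bv (lift 0 i); rewrite cons_rVE liftK.
Qed.

End lebesgue_measure_rV.

Section regularity.
Variable R : realType.

(* Class C^k in the sense of iterated directional derivatives: in finite
   dimension, [differentiable] everywhere together with the continuity of every
   ['D_v f] is the usual continuity of the differential. *)
Fixpoint Ck (V : normedModType R) (k : nat) (f : V -> R) : Prop :=
  match k with
  | 0 => continuous f
  | k'.+1 => (forall x, differentiable f x) /\ forall v, Ck k' ('D_v f)
  end.

Definition locally_lipschitz (f : R -> R) : Prop :=
  forall x : R, exists2 U, nbhs x U & [lipschitz f y | y in U].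

(* Near each of its boundary points, Omega is the set of points lying strictly
   on one side (chosen by [b]) of the graph of a smooth function [gamma]
   expressing the [i]-th coordinate in terms of the other ones. *)
Definition smooth_boundary (n : nat) (Omega : set 'rV[R]_n) : Prop :=
  forall x0, (closure Omega `\` Omega°) x0 ->
  exists (i : 'I_n) (b : bool) (gamma : 'rV[R]_n.-1 -> R),
    (forall k, Ck k gamma) /\
    \forall x \near x0,
      Omega x <-> if b then gamma (col' i x) < x 0 i else x 0 i < gamma (col' i x).

End regularity.

Section functional.
Variables (R : realType) (N : nat).
Local Notation leb := (@lebesgue_measure R).
Local Notation lebN := (lebesgue_rV R N).

Definition oriented_Rintegral (a b : R) (F : R -> R) : R :=
  if a <= b then \int[leb]_(s in `[a, b]) F s
  else - \int[leb]_(s in `[b, a]) F s.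

Definition i_integral (f finv ginv : R -> R) (m : R) : R :=
  - oriented_Rintegral 0 (f m) (fun s => ginv (finv s)).

(* Extended by 0 outside of its domain of definition [- rho, rho]. *)
Definition theta (rho h beta : R) (f finv ginv : R -> R) (m : R) : R :=
  if m \in `[- rho, rho] then
    - 2^-1 * f m ^+ 2 - h * f m - beta^-1 * i_integral f finv ginv m
  else 0.

(* For every m in [- rho, rho], the integrand of [i_integral] makes sense strictly
   between 0 and f m, i.e., finv s is there in the domain ]- rho, rho[ of ginv,
   and its integral converges. The possible singularities are at the endpoints,
   and since ginv \o finv is monotone, convergence of the improper integral
   amounts to Lebesgue integrability. *)
Definition theta_well_defined (rho : R) (f finv ginv : R -> R) : Prop :=
  forall m, m \in `[- rho, rho] ->
  let lo := Num.min 0 (f m) in let hi := Num.max 0 (f m) in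
  (forall s, s \in `]lo, hi[ -> exists2 x, x \in `]- rho, rho[ & f x = s) /\
  leb.-integrable `[lo, hi] (fun s => (ginv (finv s))%:E).

Definition free_energy (Omega : set 'rV[R]_N) (J : 'rV[R]_N -> 'rV[R]_N -> R)
    (f th : R -> R) (mbar : R) (u : 'rV[R]_N -> R) : R :=
  \int[lebN]_(x in Omega) (th (u x) - th mbar) +
  4^-1 * \int[lebN]_(x in Omega) \int[lebN]_(y in Omega)
    (J x y * (f (u x) - f (u y)) ^+ 2).

Definition lebesgue_on (Omega : set 'rV[R]_N) (oOmega : open Omega) :
    {measure set 'rV[R]_N -> \bar R} :=
  mrestr lebN (open_measurable_mx oOmega).

(* L^p(Omega): the functions are defined on R^N, but they are considered up to
   equality almost everywhere on Omega, and their norms only see Omega. *)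
Definition Lp (Omega : set 'rV[R]_N) (oOmega : open Omega) (p : \bar R)
    (p1 : (1 <= p)%E) : Type :=
  LspaceType (lebesgue_on oOmega) p1.

Definition Lp_fun Omega oOmega p p1 (u : @Lp Omega oOmega p p1) : 'rV[R]_N -> R :=
  u : LspaceType (lebesgue_on oOmega) p1.

Coercion Lp_fun : Lp >-> Funclass.

End functional.

(* Main.v *)
Require Import Defs.
From HB Require Import structures.
From mathcomp Require Import all_boot all_order all_algebra.
From mathcomp Require Import all_classical all_reals all_analysis.
From mathcomp Require Import measurable_realfun ess_sup_inf.
From mathcomp Require Import ring lra.

Set Implicit Arguments.
Unset Strict Implicit.
Unset Printing Implicit Defensive.
Import Order.TTheory GRing.Theory Num.Theory.
Import numFieldNormedType.Exports.

Local Open Scope classical_set_scope.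
Local Open Scope ring_scope.

(** The functional only sees the values of [f] and [theta] on [[- rho, rho]],
because a function whose essential supremum is at most [rho] agrees almost
everywhere with its truncation to that interval. So the question is whether
two continuous functions of one variable, precomposed with the truncation
[clip], give functionals that are continuous for the L^p norm.

The domain Omega is bounded, hence of finite measure, and the L^1 norm is
dominated by a multiple of the L^p norm ([Lnorm1_le_Lnorm]). A continuous
function on a compact interval satisfies, for every [e > 0], an estimate
[|phi x - phi y| <= e + C |x - y|] ([clip_modulus]); integrating it shows that
[u |-> phi (clip u)] is continuous from L^p to L^1 ([nemytskii_continuous]).

For the local term, the estimate is applied to [theta], whose continuity on
[[- rho, rho]] up to the end points is the one delicate point: [ginv] may blow
up at [- rho] and [rho], but [theta] involves a primitive of an integrable
function, evaluated at the continuous function [f] ([theta_continuous]).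

For the interaction term, the estimate is applied to [f]. On functions bounded
by [M], the double integral of [J(x,y) (P x - P y)^2] is Lipschitz for the L^1
norm with constant [8 M] ([interaction_lipschitz]): the difference of two
squares is at most [4 M] times the sum of the increments at [x] and at [y], and
the two marginals of [J] are at most one. *)

(** * Truncation to an interval *)

Definition clip (R : realType) (a b x : R) : R := Num.max a (Num.min x b).

Section clip.
Variables (R : realType) (a b : R).
Hypothesis ab : a <= b.

Lemma clip_itv x : clip a b x \in `[a, b].
Proof. by rewrite in_itv/= le_max lexx ge_max ab ge_min lexx orbT. Qed.

Lemma clip_id x : x \in `[a, b] -> clip a b x = x.
Proof. by rewrite in_itv/= /clip => /andP[ax /min_idPl ->]; apply/max_idPr. Qed.

Lemma clip_lip x y : `|clip a b x - clip a b y| <= `|x - y|.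
Proof.
have := ler_norm (x - y); have := ler_norm (y - x); rewrite (distrC y x).
rewrite /clip; case: (leP x b); case: (leP y b) => ? ?;
  case: (leP a x); case: (leP a y); case: (leP a b) => ? ? ? ? ?;
  rewrite ler_norml; apply/andP; split; lra.
Qed.

Lemma continuous_clip : continuous (clip a b).
Proof.
move=> x; apply/cvgrPdist_le => e e0.
apply: filterS (nbhsx_ballx x e e0) => y xy.
by apply: (le_trans (clip_lip _ _)); exact: ltW.
Qed.

Lemma within_continuous_clip (V : topologicalType) (phi : R -> V) :
  {within `[a, b], continuous phi} -> continuous (phi \o clip a b).
Proof.
move=> /subspace_continuousP cphi x.
have cx : clip a b @ x --> within `[a, b] (nbhs (clip a b x)).
  move=> U HU; have := @continuous_clip x _ HU.
  by apply: (@filterS _ (nbhs x)) => y /=; apply; exact: clip_itv.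
exact: cvg_comp cx (cphi _ (clip_itv x)).
Qed.

(** Uniform continuity, in a form that can be integrated directly: at small
distances the oscillation is below [e], and at larger distances the linear
term exceeds the total oscillation. *)
Lemma clip_modulus (phi : R -> R) : continuous phi -> forall e : R, 0 < e ->
  exists2 C : R, 0 <= C & forall x y,
    `|phi (clip a b x) - phi (clip a b y)| <= e + C * `|x - y|.
Proof.
move=> cphi e e0.
have wphi : {within `[a, b], continuous phi}.
  exact: continuous_subspaceT.
have [xM _ hM] := EVT_max ab wphi.
have [xm _ hm] := EVT_min ab wphi.
pose M := phi xM - phi xm.
have phiM x y : x \in `[a, b] -> y \in `[a, b] -> `|phi x - phi y| <= M.
  move=> xab yab; have := hM _ xab; have := hM _ yab; have := hm _ xab.
  by have := hm _ yab; rewrite ler_norml /M => *; apply/andP; split; lra.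
have : \forall C \near +oo, `[a, b] `<=` (fun x => forall y, y \in `[a, b] ->
    `|phi x - phi y| <= e + C * `|x - y|).
  have /compact_near_coveringP/near_covering_withinP := @segment_compact R a b.
  apply=> x xab.
  have e20 : 0 < e / 2 by rewrite divr_gt0.
  have /cvgrPdist_le /(_ _ e20) /nbhs_ballP[r /= r0 rP] : phi @ x --> phi x.
    exact: cphi.
  have r20 : 0 < r / 2 by rewrite divr_gt0.
  (* Halving the radius leaves room for [y] to stay in the ball of radius [r]
     around [x] when it is close to a neighbour [z] of [x]; otherwise
     [|z - y| >= r / 2] and a slope [M / (r / 2)] beats the oscillation [M]. *)
  exists (ball x (r / 2), [set C | Num.max 0 (M / (r / 2)) <= C]).
    split => /=; first exact: nbhsx_ballx.
    by apply: nbhs_pinfty_ge; rewrite num_real.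
  move=> [z C] [/= xz]; rewrite ge_max => /andP[C0 CM] zab y yab.
  have [yz|yz] := ltP `|z - y| (r / 2).
    have xr : `|phi x - phi z| <= e / 2.
      apply: rP; apply: le_ball xz.
      by rewrite ler_pdivrMr// ler_pMr// ler1n.
    have yr : `|phi x - phi y| <= e / 2.
      by apply: rP; rewrite [r]splitr; exact: ball_triangle xz yz.
    apply: (le_trans (ler_distD (phi x) _ _)); rewrite (distrC (phi z)).
    by rewrite [e]splitr; apply: ler_wpDr; [rewrite mulr_ge0|exact: lerD].
  have := phiM _ _ zab yab.
  suff : M <= C * `|z - y| by lra.
  apply: (@le_trans _ _ (C * (r / 2))); first by rewrite -ler_pdivrMr.
  by rewrite ler_wpM2l.
move=> [C0 [_ HC]].
have C1 : C0 < Num.max 0 (C0 + 1) by rewrite lt_max ltrDl ltr01 orbT.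
exists (Num.max 0 (C0 + 1)) => [|x y]; first by rewrite le_max lexx.
apply: (le_trans (HC _ C1 _ (clip_itv x) _ (clip_itv y))).
by rewrite lerD2l ler_wpM2l ?clip_lip// le_max lexx.
Qed.

End clip.

(** * Measurability and finiteness for row vectors *)

Lemma continuous_measurable_rV (R : realType) n (phi : 'rV[R]_n -> R) :
  continuous phi -> measurable_fun [set: 'rV[R]_n] (phi : _ -> measurableTypeR R).
Proof.
move=> /continuousP cphi; apply: (measurability _ (RGenOpens.measurableE R)).
move=> _ [_ [a [b ->] <-]]; rewrite setTI; apply: open_measurable_mx.
exact/cphi/interval_open.
Qed.

Lemma measurable_row_mx (R : realType) m n :
  measurable_fun [set: 'rV[R]_m * 'rV[R]_n]
    (fun z : 'rV[R]_m * 'rV[R]_n => row_mx z.1 z.2).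
Proof.
apply: measurable_fun_mx => i j.
have -> : (fun z : 'rV[R]_m * 'rV[R]_n => row_mx z.1 z.2 i j) =
    match fintype.split j with
    | inl k => fun z => z.1 i k | inr k => fun z => z.2 i k end.
  by apply/funext => z; rewrite mxE; case: (fintype.split j).
case: (fintype.split j) => k.
  exact: (measurableT_comp (@measurable_mx_coord R 1 m i k) measurable_fst).
exact: (measurableT_comp (@measurable_mx_coord R 1 n i k) measurable_snd).
Qed.

(** The product sigma-algebra is reached through the concatenation with values
in [R^(m + n)], where open sets are already known to be measurable. *)
Lemma continuous_measurable_prod_rV (R : realType) m n
    (phi : 'rV[R]_m * 'rV[R]_n -> R) : continuous phi ->
  measurable_fun [set: 'rV[R]_m * 'rV[R]_n] (phi : _ -> measurableTypeR R).
Proof.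
move=> cphi.
pose split_rV (v : 'rV[R]_(m + n)) := (lsubmx v, rsubmx v).
have csplit : continuous split_rV.
  move=> v U /nbhs_ballP[e /= e0 eU]; apply/nbhs_ballP; exists e => //= w [_ vw].
  by apply: eU; split; split => // i j; rewrite !mxE.
have -> : phi = (phi \o split_rV) \o (fun z => row_mx z.1 z.2).
  by apply/funext => -[x y] /=; rewrite /split_rV row_mxKl row_mxKr.
apply: measurableT_comp (@measurable_row_mx R m n).
apply: continuous_measurable_rV => v.
by apply: continuous_comp; [exact: csplit|exact: cphi].
Qed.

Lemma lebesgue_rV_bounded_lty (R : realType) n (A : set 'rV[R]_n) :
  measurable A -> bounded_set A -> (lebesgue_rV R n A < +oo)%E.
Proof.
move=> mA [M0 [_ HM]]; pose M := M0 + 1.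
have AM : A `<=` [set v | `|v| <= M] by apply: HM; rewrite ltrDl.
pose B (i : 'I_n) : set (measurableTypeR R) := `[- M, M]%classic.
have mB i : measurable (B i) by exact: measurable_itv.
have mbox : measurable [set v : 'rV[R]_n | forall i, B i (v 0 i)].
  rewrite [X in measurable X](_ : _ = \bigcap_i [set v : 'rV[R]_n | B i (v 0 i)]).
    apply: fin_bigcap_measurable => [|i _]; first exact: finite_finset.
    rewrite -[X in measurable X]setTI.
    by apply: (@measurable_mx_coord R 1 n 0 i measurableT); exact: mB.
  by apply/seteqP; split => v /= bv i; [move=> _; exact: bv|exact: bv].
apply: (@le_lt_trans _ _ (lebesgue_rV R n [set v | forall i, B i (v 0 i)])).
  apply: le_measure; rewrite ?inE// => v Av i; rewrite /B/= in_itv/= -ler_norml.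
  apply: le_trans (AM _ Av).
  rewrite [`|v|]mx_normE.
  by rewrite num_le/=; exact: (le_bigmax _ (fun ij => `|v ij.1 ij.2|%:nng) (0, i)).
rewrite lebesgue_rV_box//.
have : \big[*%E/1%E]_(i < n) lebesgue_measure (B i) \is a fin_num.
  elim/big_ind : _ => [//|x y|i _]; first exact: fin_numM.
  by rewrite /B lebesgue_measure_itv/=; case: ifP.
by move=> /fin_numPlt/andP[].
Qed.

(** * Comparison of Lebesgue norms *)

Section finite_measure_Lnorm.
Context d (T : measurableType d) (R : realType).
Variable mu : {measure set T -> \bar R}.
Hypothesis muT : (mu [set: T] < +oo)%E.

(** Hölder's inequality against the constant function 1. *)
Lemma Lnorm1_le_Lnorm (p : \bar R) : (1 <= p)%E ->
  exists2 C : R, 0 < C & forall w : T -> R, measurable_fun setT w ->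
    ('N[mu]_1%E [EFin \o w] <= C%:E * 'N[mu]_p [EFin \o w])%E.
Proof.
have muTfin : mu [set: T] \is a fin_num by rewrite ge0_fin_numE.
case: p => [r| |//] p1.
- have [->|r1] := eqVneq r 1; first by exists 1 => // w mw; rewrite mul1e.
  have {}p1 : 1 < r by rewrite lt_neqAle eq_sym r1 -lee_fin.
  have r0 : 0 < r by exact: lt_trans p1.
  pose q := (1 - r^-1)^-1.
  have q0 : 0 < q by rewrite invr_gt0 subr_gt0 invf_lt1.
  have rq : r^-1 + q^-1 = 1 by rewrite invrK subrKC.
  pose K := (mu [set: T] `^ q^-1)%E.
  have K0 : (0 <= K)%E by exact: poweR_ge0.
  have Kfin : K \is a fin_num by rewrite fin_num_poweR.
  exists (fine K + 1) => [|w mw]; first by rewrite ltr_wpDl ?fine_ge0.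
  have m1 : measurable_fun setT (cst 1 : T -> R) by [].
  have := @hoelder _ _ _ mu w (cst 1) r q mw m1 r0 q0 rq.
  rewrite Lnorm_cst1 -/K.
  rewrite (_ : (w \* cst 1)%R = w); last by apply/funext => x /=; rewrite mulr1.
  move=> /le_trans; apply; rewrite muleC lee_wpmul2r ?Lnorm_ge0//.
  by rewrite -[leLHS]fineK// lee_fin lerDl.
- exists (fine (mu [set: T]) + 1) => [|w mw].
    by rewrite ltr_wpDl// fine_ge0.
  rewrite Lnorm1.
  have ae_bound : {ae mu, forall x, setT x ->
      (abse (EFin (w x)) <= cst ('N[mu]_+oo%E [EFin \o w]) x)%E}.
    rewrite unlock /Lnorm; case: ifPn => mu0.
      by apply: filterS (ess_sup_ge mu (abse \o (EFin \o w))) => x.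
    exists setT; split => //; apply/eqP.
    by rewrite eq_le measure_ge0 andbT leNgt.
  have N0 := Lnorm_ge0 mu +oo%E (EFin \o w).
  have mNw : measurable_fun setT (abse \o (EFin \o w)).
    by apply: measurableT_comp => //; exact/measurable_EFinP.
  apply: le_trans (ae_ge0_le_integral measurableT _ mNw _ _ ae_bound) _ => //.
    by move=> x _; exact: abse_ge0.
  rewrite integral_cst// muleC lee_wpmul2r//.
  by rewrite -[leLHS]fineK// lee_fin lerDl.
Qed.

End finite_measure_Lnorm.

(** * The interaction term *)

Lemma le_dist_Rintegral d (T : measurableType d) (R : realType)
    (mu : {measure set T -> \bar R}) (P Q : T -> R) :
  mu.-integrable setT (EFin \o P) -> mu.-integrable setT (EFin \o Q) ->
  (`|\int[mu]_x P x - \int[mu]_x Q x|%R%:E <= \int[mu]_x `|P x - Q x|%:E)%E.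
Proof.
move=> iP iQ.
have iPQ : mu.-integrable setT (EFin \o (fun x => P x - Q x)).
  by have := integrableB measurableT iP iQ; apply: eq_integrable.
rewrite -RintegralB//.
have := le_normr_Rintegral measurableT iPQ; rewrite -lee_fin.
move/le_trans; apply; rewrite /Rintegral fineK//.
by have /integrable_abse/integrable_fin_num := iPQ; exact.
Qed.

Section interaction.
Context d (T : measurableType d) (R : realType).
Variables (mu : {finite_measure set T -> \bar R}) (J : T * T -> R).
Hypotheses (mJ : measurable_fun setT J) (J_ge0 : forall z, 0 <= J z).
Hypothesis J_int2 : forall x, (\int[mu]_y (J (x, y))%:E <= 1)%E.
Hypothesis J_int1 : forall y, (\int[mu]_x (J (x, y))%:E <= 1)%E.

Definition interaction (P : T -> R) : R :=
  \int[mu]_x \int[mu]_y (J (x, y) * (P x - P y) ^+ 2).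

Local Notation pi := (mu \x mu)%E.
Let K (P : T -> R) (z : T * T) : R := J z * (P z.1 - P z.2) ^+ 2.

(** By Tonelli, integrating out the other variable costs a factor which is a
marginal of [J], hence at most 1. *)
Lemma integral_kernel_fst (a : T -> R) : measurable_fun setT a ->
  (forall x, 0 <= a x) ->
  (\int[mu \x mu]_z (J z * a z.1)%:E <= \int[mu]_x (a x)%:E)%E.
Proof.
move=> ma a0.
have mJa : measurable_fun setT (EFin \o (fun z => J z * a z.1)).
  apply/measurable_EFinP/measurable_funM => //.
  exact: measurableT_comp ma measurable_fst.
have Ja0 z : (0 <= (J z * a z.1)%:E)%E by rewrite lee_fin mulr_ge0.
rewrite fubini_tonelli1//; apply: ge0_le_integral => //.
- by move=> x _; apply: integral_ge0.
- exact: (measurable_fun_fubini_tonelli_F _ mJa).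
- exact/measurable_EFinP.
move=> x _; rewrite /fubini_F/=.
under eq_integral do rewrite mulrC EFinM.
rewrite ge0_integralZl//; first last.
- by rewrite lee_fin.
- by move=> y _; rewrite lee_fin.
- apply/measurable_EFinP. exact/(measurableT_comp mJ (measurable_pair1 x)).
by rewrite -[leRHS]mule1 lee_pmul ?lee_fin// integral_ge0// => y _; rewrite lee_fin.
Qed.

Lemma integral_kernel_snd (a : T -> R) : measurable_fun setT a ->
  (forall x, 0 <= a x) ->
  (\int[mu \x mu]_z (J z * a z.2)%:E <= \int[mu]_x (a x)%:E)%E.
Proof.
move=> ma a0.
have mJa : measurable_fun setT (EFin \o (fun z => J z * a z.2)).
  apply/measurable_EFinP/measurable_funM => //.
  exact: measurableT_comp ma measurable_snd.
have Ja0 z : (0 <= (J z * a z.2)%:E)%E by rewrite lee_fin mulr_ge0.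
rewrite fubini_tonelli2//; apply: ge0_le_integral => //.
- by move=> y _; apply: integral_ge0.
- exact: (measurable_fun_fubini_tonelli_G _ mJa).
- exact/measurable_EFinP.
move=> y _; rewrite /fubini_G/=.
under eq_integral do rewrite mulrC EFinM.
rewrite ge0_integralZl//; first last.
- by rewrite lee_fin.
- by move=> x _; rewrite lee_fin.
- exact/measurable_EFinP/(measurableT_comp mJ (measurable_pair2 y)).
by rewrite -[leRHS]mule1 lee_pmul ?lee_fin// integral_ge0// => x _; rewrite lee_fin.
Qed.

Let measurable_K (P : T -> R) : measurable_fun setT P -> measurable_fun setT (K P).
Proof.
move=> mP; apply: measurable_funM => //; apply: measurable_funX.
by apply: measurable_funB;
  [exact: measurableT_comp mP measurable_fst|exact: measurableT_comp mP measurable_snd].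
Qed.

Let K_ge0 P z : 0 <= K P z.
Proof. by rewrite mulr_ge0// sqr_ge0. Qed.

Lemma measurable_inner (P : T -> R) : measurable_fun setT P ->
  measurable_fun setT (fun x => \int[mu]_y (J (x, y) * (P x - P y) ^+ 2)).
Proof.
move=> mP; apply: measurableT_comp => //.
apply: (@measurable_fun_fubini_tonelli_F _ _ _ _ _ mu (EFin \o K P)) => [|z /=].
  apply/measurable_EFinP; exact: (measurable_K mP).
by rewrite lee_fin.
Qed.

Lemma le_sqr_diff (M a b : R) : `|a| <= M -> `|b| <= M ->
  (a - b) ^+ 2 <= 4 * M ^+ 2.
Proof.
move=> aM bM; have := sqr_ge0 (M - a); have := sqr_ge0 (M - b).
by move: aM bM; rewrite !ler_norml => /andP[? ?] /andP[? ?]; nra.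
Qed.

Section bounded.
Variables (M : R) (M0 : 0 <= M).

Let K_bound (P : T -> R) x y : (forall x, `|P x| <= M) ->
  K P (x, y) <= J (x, y) * (4 * M ^+ 2).
Proof. by move=> PM; rewrite ler_wpM2l//; exact: le_sqr_diff. Qed.

Let integrable_K (P : T -> R) : measurable_fun setT P -> (forall x, `|P x| <= M) ->
  pi.-integrable setT (EFin \o K P).
Proof.
move=> mP PM; apply/integrableP; split.
  apply/measurable_EFinP; exact: (measurable_K mP).
apply: (@le_lt_trans _ _ (\int[pi]_z (J z * cst (4 * M ^+ 2)%R z.1)%:E)%E).
  apply: ge0_le_integral => //.
  - by apply: measurableT_comp => //; apply/measurable_EFinP; exact: (measurable_K mP).
  - by apply/measurable_EFinP/measurable_funM.
  - by move=> [x y] _; rewrite lee_fin ger0_norm ?K_ge0// K_bound.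
apply: (le_lt_trans (integral_kernel_fst _ _)) => //.
  by move=> x /=; rewrite mulr_ge0// sqr_ge0.
rewrite (integral_cst mu measurableT (4 * M ^+ 2)%:E).
by rewrite lte_mul_pinfty// ?lee_fin ?mulr_ge0 ?sqr_ge0 ?fin_num_fun_lty.
Qed.

(** The inner integral is a real number obtained by truncating an extended real
one; its finiteness for every [x] is what allows the iterated integral to be
replaced by an integral for the product measure. *)
Lemma interactionE (P : T -> R) : measurable_fun setT P -> (forall x, `|P x| <= M) ->
  interaction P = \int[pi]_z K P z.
Proof.
move=> mP PM; rewrite /interaction /Rintegral; congr fine.
rewrite fubini_tonelli1//=; last 2 first.
- apply/measurable_EFinP; exact: (measurable_K mP).
- by move=> z; rewrite lee_fin.
apply: eq_integral => x _; rewrite fineK// ge0_fin_numE; last first.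
  by apply: integral_ge0 => y _; rewrite lee_fin; exact: (K_ge0 P (x, y)).
apply: (@le_lt_trans _ _ (\int[mu]_y ((4 * M ^+ 2)%:E * (J (x, y))%:E))%E).
  apply: ge0_le_integral => //.
  - by move=> y _; rewrite lee_fin; exact: (K_ge0 P (x, y)).
  - apply/measurable_EFinP.
    exact: (measurableT_comp (measurable_K mP) (measurable_pair1 x)).
  - apply/measurable_EFinP/measurable_funM => //.
    exact: (measurableT_comp mJ (measurable_pair1 x)).
  - by move=> y _; rewrite -EFinM lee_fin [leRHS]mulrC; exact: (K_bound x y PM).
rewrite ge0_integralZl//; first last.
- by rewrite lee_fin mulr_ge0// sqr_ge0.
- by move=> y _; rewrite lee_fin.
- exact/measurable_EFinP/(measurableT_comp mJ (measurable_pair1 x)).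
rewrite lte_mul_pinfty// ?lee_fin ?mulr_ge0 ?sqr_ge0//.
by rewrite (le_lt_trans (J_int2 x))// ltry.
Qed.

(** With [a = |P - Q|], the identity [s^2 - t^2 = (s - t) (s + t)] bounds the
difference of the integrands by [4 M J(x,y) (a x + a y)], and each of the two
terms integrates to at most [4 M] times the integral of [a]. *)
Lemma interaction_lipschitz (P Q : T -> R) :
  measurable_fun setT P -> measurable_fun setT Q ->
  (forall x, `|P x| <= M) -> (forall x, `|Q x| <= M) ->
  (`|interaction P - interaction Q|%:E
     <= (8 * M)%:E * \int[mu]_x `|P x - Q x|%:E)%E.
Proof.
move=> mP mQ PM QM.
have iP := integrable_K mP PM; have iQ := integrable_K mQ QM.
pose a x := `|P x - Q x|.
have ma : measurable_fun setT a.
  by apply: measurableT_comp => //; exact: measurable_funB.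
have a0 x : 0 <= a x by exact: normr_ge0.
have ma1 : measurable_fun setT (EFin \o (fun z => J z * a z.1)).
  apply/measurable_EFinP/measurable_funM => //.
  exact: measurableT_comp ma measurable_fst.
have ma2 : measurable_fun setT (EFin \o (fun z => J z * a z.2)).
  apply/measurable_EFinP/measurable_funM => //.
  exact: measurableT_comp ma measurable_snd.
rewrite !interactionE//; apply: (le_trans (le_dist_Rintegral iP iQ)).
have J1 z : (0 <= (J z * a z.1)%:E)%E by rewrite lee_fin mulr_ge0.
have J2 z : (0 <= (J z * a z.2)%:E)%E by rewrite lee_fin mulr_ge0.
apply: (@le_trans _ _
  (\int[pi]_z ((4 * M)%:E * ((J z * a z.1)%:E + (J z * a z.2)%:E)))%E).
  apply: ge0_le_integral => //.
  - apply/measurable_EFinP; apply: measurableT_comp => //.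
    by apply: measurable_funB; exact: measurable_K.
  - by apply: emeasurable_funM => //; exact: emeasurable_funD.
  - move=> [x y] _; rewrite -EFinD -EFinM lee_fin /K/= -mulrBr normrM ger0_norm//.
    rewrite -mulrDr mulrCA ler_wpM2l//.
    rewrite subr_sqr normrM.
    have -> : P x - P y - (Q x - Q y) = (P x - Q x) - (P y - Q y) by ring.
    have PxM := PM x; have PyM := PM y; have QxM := QM x; have QyM := QM y.
    rewrite mulrC; apply: ler_pM => //; last exact: ler_normB.
    have -> : 4 * M = (M + M) + (M + M) by ring.
    by apply: (le_trans (ler_normD _ _)); apply: lerD;
      apply: (le_trans (ler_normB _ _)); exact: lerD.
rewrite ge0_integralZl//; first last.
- by rewrite lee_fin mulr_ge0.
- by move=> z _; exact: adde_ge0.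
- exact: emeasurable_funD.
rewrite ge0_integralD//.
have -> : 8 * M = 4 * M * 2 by ring.
rewrite (EFinM (4 * M) 2) -muleA lee_wpmul2l// ?lee_fin ?mulr_ge0//.
rewrite mule_natl mule2n.
by apply: leeD; [exact: integral_kernel_fst|exact: integral_kernel_snd].
Qed.

End bounded.
End interaction.

(** * Continuity of theta *)

Lemma locally_lipschitz_continuous (R : realType) (f : R -> R) :
  locally_lipschitz f -> continuous f.
Proof.
move=> flip x; have [U nU [k0 [_ Uk0]]] := flip x.
pose k := Num.max 1 (k0 + 1).
have k_gt0 : 0 < k by rewrite lt_max ltr01.
have k0k : k0 < k by rewrite lt_max ltrDl ltr01 orbT.
apply/cvgrPdist_le => e e0.
have ek : 0 < e / k by rewrite divr_gt0.
near=> y.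
have Uy : U y by near: y.
have /= fxy := Uk0 _ k0k (x, y) (conj (nbhs_singleton nU) Uy).
apply: (le_trans fxy); rewrite mulrC -ler_pdivlMr//.
Unshelve. all: by end_near. Qed.

Lemma integrable_setU d (T : measurableType d) (R : realType)
    (mu : {measure set T -> \bar R}) (A B : set T) (f : T -> \bar R) :
  measurable A -> measurable B ->
  mu.-integrable A f -> mu.-integrable B f -> mu.-integrable (A `|` B) f.
Proof.
move=> mA mB iA iB;
have mD := measurableD mB mA.
have iD : mu.-integrable (B `\` A) f by apply: integrableS iB => //; exact: subDsetl.
have -> : A `|` B = A `|` (B `\` A).
  apply/seteqP; split => x [Ax|]; [by left| |by left|by case=> Bx _; right].
  by move=> Bx; have [Ax|nAx] := pselect (A x); [left|right].
have mf : measurable_fun (A `|` (B `\` A)) f.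
  by apply/measurable_funU => //; split;
    [exact: measurable_int iA|exact: measurable_int iD].
apply/integrableP; split => //; rewrite ge0_integral_setU//.
- by apply: lte_add_pinfty; [case/integrableP: iA|case/integrableP: iD].
- exact: measurableT_comp.
- by apply/disj_setPS => x [Ax []].
Qed.

Section primitive.
Variables (R : realType) (A B : R) (G : R -> R).
Local Notation leb := (@lebesgue_measure R).
Hypotheses (A0 : A <= 0) (B0 : 0 <= B).
Hypothesis intG : leb.-integrable `[A, B] (EFin \o G).

Lemma oriented_RintegralE t : t \in `[A, B] ->
  oriented_Rintegral 0 t G =
  parameterized_integral leb A t G - parameterized_integral leb A 0 G.
Proof.
rewrite in_itv/= => /andP[At tB].
rewrite /oriented_Rintegral /parameterized_integral; case: ifPn => [t0|].
  have iAt : leb.-integrable `[A, t] (EFin \o G).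
    by apply: integrableS intG => //; exact: subset_itvl.
  rewrite Rintegral_itvB//= Rintegral_itv_obnd_cbnd//.
  by apply: integrableS intG => //; apply: subset_itv; rewrite bnd_simp.
rewrite -ltNge => /ltW t0.
have iA0 : leb.-integrable `[A, 0] (EFin \o G).
  by apply: integrableS intG => //; exact: subset_itvl.
rewrite -[RHS]opprB Rintegral_itvB//= Rintegral_itv_obnd_cbnd//.
by apply: integrableS intG => //; apply: subset_itv; rewrite bnd_simp.
Qed.

(** This holds up to the end points [A] and [B], where [G] may be unbounded, by
absolute continuity of the integral. *)
Lemma continuous_oriented_Rintegral_clip :
  continuous (fun t => oriented_Rintegral 0 (clip A B t) G).
Proof.
have AB : A <= B by exact: le_trans B0.
under eq_fun do rewrite oriented_RintegralE ?clip_itv//.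
move=> t; apply: cvgB; last exact: cvg_cst.
exact: (within_continuous_clip AB (parameterized_integral_continuous AB intG)).
Qed.

End primitive.

(** The values of [f] on [[- rho, rho]] lie between its extrema [f m] and [f M],
so the integrals occurring in [theta] are all taken inside [[A, B]], the convex
hull of [0], [f m] and [f M]. Integrability on this interval is integrability
on its two halves, which the well-definedness of [theta] provides at the points
[m] and [M]. The continuity is expressed by a continuous extension to the whole
line since [theta] itself drops to 0 outside of [[- rho, rho]]. *)
Lemma theta_continuous (R : realType) (rho h beta : R) (f finv ginv : R -> R) :
  0 < rho -> continuous f -> theta_well_defined rho f finv ginv ->
  exists2 th : R -> R, continuous th &
    forall m, m \in `[- rho, rho] -> theta rho h beta f finv ginv m = th m.
Proof.
move=> rho0 cf wd; pose G s := ginv (finv s).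
have rr : - rho <= rho by lra.
have wf : {within `[- rho, rho], continuous f} by exact: continuous_subspaceT.
have [M Mr fM] := EVT_max rr wf.
have [m mr fm] := EVT_min rr wf.
pose A := Num.min 0 (f m); pose B := Num.max 0 (f M).
have A0 : A <= 0 by rewrite ge_min lexx.
have B0 : 0 <= B by rewrite le_max lexx.
have [_ iM] := wd _ Mr; have [_ im] := wd _ mr.
have iA : lebesgue_measure.-integrable `[A, 0] (EFin \o G).
  apply: integrableS im => //; apply: subset_itv; rewrite bnd_simp//.
  by rewrite le_max lexx.
have iB : lebesgue_measure.-integrable `[0, B] (EFin \o G).
  apply: integrableS iM => //; apply: subset_itv; rewrite bnd_simp//.
  by rewrite ge_min lexx.
have iAB : lebesgue_measure.-integrable `[A, B] (EFin \o G).
  have -> : `[A, B]%classic = `[A, 0] `|` `[0, B].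
    apply/seteqP; split => x /=; rewrite !in_itv/=.
      by move=> /andP[-> ->]; case: (leP x 0) => [_|/ltW ->]; [left|right].
    by case=> /andP[? ?]; apply/andP; split => //;
      exact: le_trans B0 || exact: le_trans A0 _.
  exact: integrable_setU.
exists (fun x => - 2^-1 * f x ^+ 2 - h * f x +
    beta^-1 * oriented_Rintegral 0 (clip A B (f x)) G) => [x|x xr].
  apply: cvgD; [apply: cvgB|].
  - apply: cvgM; first exact: cvg_cst.
    by apply: cvgM; exact: cf.
  - by apply: cvgM; [exact: cvg_cst|exact: cf].
  - apply: cvgM; first exact: cvg_cst.
    apply: (@continuous_comp _ _ _ f (fun t => oriented_Rintegral 0 (clip A B t) G)).
      exact: cf.
    exact: continuous_oriented_Rintegral_clip.
rewrite /theta xr /i_integral mulrN opprK clip_id// in_itv/=.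
by rewrite ge_min le_max fm// fM// !orbT.
Qed.

(** * Superposition operators *)

Section nemytskii.
Context d (T : measurableType d) (R : realType).
Variable mu : {measure set T -> \bar R}.
Hypothesis muT : (mu [set: T] < +oo)%E.
Variables (a b : R) (ab : a <= b).

(** The integral of [eta + C |v - u|] is the sum of [eta] times the total mass,
made smaller than [e / 2] by the choice of [eta], and of [C] times the L^1 norm
of [v - u], made smaller than [e / 2] by the choice of the radius. *)
Lemma nemytskii_continuous (p : \bar R) (phi : R -> R) : (1 <= p)%E ->
  continuous phi -> forall e : R, 0 < e ->
  exists2 del : R, 0 < del & forall u v : T -> R,
    measurable_fun setT u -> measurable_fun setT v ->
    ('N[mu]_p [EFin \o (v \- u)%R] < del%:E)%E ->
    (\int[mu]_x `|phi (clip a b (v x)) - phi (clip a b (u x))|%:E < e%:E)%E.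
Proof.
move=> p1 cphi e e0.
have [K K0 N1p] := Lnorm1_le_Lnorm muT p1.
have muTfin : mu [set: T] \is a fin_num by rewrite ge0_fin_numE.
pose m := fine (mu [set: T]).
have m0 : 0 <= m by exact: fine_ge0.
pose eta := e / 2 / (m + 1).
have eta0 : 0 < eta by rewrite !divr_gt0// ltr_wpDl.
have [C C0 HC] := clip_modulus ab cphi eta0.
exists (e / 2 / ((C + 1) * K)) => [|u v mu_ mv uv].
  by rewrite !divr_gt0// mulr_gt0// ltr_wpDl.
have cphic : continuous (phi \o clip a b).
  by move=> x; apply: continuous_comp; [exact: continuous_clip|exact: cphi].
have mphic : measurable_fun setT (phi \o clip a b).
  exact: continuous_measurable_fun.
have mvu : measurable_fun setT (v \- u) by exact: measurable_funB.
have mnvu : measurable_fun setT (fun x => `|v x - u x|).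
  exact: measurableT_comp mvu.
apply: (@le_lt_trans _ _ (\int[mu]_x (eta%:E + C%:E * `|v x - u x|%:E))%E).
  apply: ge0_le_integral => //.
  - apply/measurable_EFinP; apply: measurableT_comp => //.
    by apply: measurable_funB;
      [exact: (measurableT_comp mphic mv)|exact: (measurableT_comp mphic mu_)].
  - apply/measurable_EFinP; apply: measurable_funD => //.
    exact: measurable_funM.
  - by move=> x _; rewrite -EFinM -EFinD lee_fin; exact: HC.
rewrite ge0_integralD//; first last.
- by apply/measurable_EFinP; exact: measurable_funM.
- by move=> x _; rewrite -EFinM lee_fin mulr_ge0.
- by move=> x _; rewrite lee_fin ltW.
rewrite (integral_cst mu measurableT eta%:E) ge0_integralZl//; first last.
- exact/measurable_EFinP.
have N1E : (\int[mu]_x `|v x - u x|%:E = 'N[mu]_1%E [EFin \o (v \- u)%R])%E.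
  by rewrite Lnorm1.
rewrite N1E -(fineK muTfin) -/m [e]splitr EFinD.
apply: lee_ltD => //.
- rewrite -EFinM lee_fin /eta mulrAC ler_pdivrMr ?ltr_wpDl// ler_wpM2l//; lra.
- apply: (@le_lt_trans _ _ (((C + 1) * K)%:E * 'N[mu]_p[EFin \o (v \- u)%R])%E).
    rewrite EFinM -muleA; apply: lee_pmul => //.
    + by rewrite Lnorm_ge0.
    + by rewrite lee_fin lerDl.
    + exact: N1p.
  have -> : (e / 2)%:E = (((C + 1) * K)%:E * (e / 2 / ((C + 1) * K))%:E)%E.
    rewrite -EFinM; congr (_%:E);
    rewrite [RHS]mulrC divfK// mulf_neq0// ?(gt_eqF K0)// gt_eqF// ltr_wpDl//.
  rewrite lte_pmul2l// lte_fin mulr_gt0// ltr_wpDl//.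
Qed.

End nemytskii.

(** * Reduction to a finite measure *)

Lemma integral_mrestr d (T : measurableType d) (R : realType)
    (mu : {measure set T -> \bar R}) (D : set T) (mD : measurable D)
    (phi : T -> \bar R) : measurable_fun setT phi ->
  (\int[mu]_(x in D) phi x = \int[mrestr mu mD]_x phi x)%E.
Proof.
move=> mphi.
rewrite (eq_measure_integral (mrestr mu mD)) => [|A mA AD]; last first.
  by rewrite /= /mrestr setIidl.
rewrite integral_mkcond; apply: ae_eq_integral => //.
  by apply/(measurable_restrictT _ mD); exact: measurable_funTS.
exists (~` D); split; [exact: measurableC|by rewrite /= /mrestr setICl measure0|].
move=> x /= nx Dx; apply: nx => _; rewrite patchE ifT//; exact: mem_set.
Qed.

Lemma Rintegral_mrestr d (T : measurableType d) (R : realType)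
    (mu : {measure set T -> \bar R}) (D : set T) (mD : measurable D)
    (phi : T -> R) : measurable_fun setT phi ->
  \int[mu]_(x in D) phi x = \int[mrestr mu mD]_x phi x.
Proof.
by move=> mphi; rewrite /Rintegral (integral_mrestr mu mD)//; exact/measurable_EFinP.
Qed.

Lemma ae_eq_Rintegral d (T : measurableType d) (R : realType)
    (mu : {measure set T -> \bar R}) (P Q : T -> R) :
  measurable_fun setT P -> measurable_fun setT Q ->
  {ae mu, forall x, P x = Q x} -> \int[mu]_x P x = \int[mu]_x Q x.
Proof.
move=> mP mQ PQ; congr fine; apply: ae_eq_integral => //.
- exact/measurable_EFinP.
- exact/measurable_EFinP.
- by apply: filterS PQ => x /= -> _.
Qed.

(** When the total mass vanishes, the norm is 0 by convention and carries no
information, but every property holds almost everywhere. *)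
Lemma ae_le_of_Lnormy_le d (T : measurableType d) (R : realType)
    (mu : {measure set T -> \bar R}) (w : T -> R) (r : R) :
  ('N[mu]_+oo%E [EFin \o w] <= r%:E)%E -> {ae mu, forall x, `|w x| <= r}.
Proof.
rewrite unlock /Lnorm; case: ifPn => [mu0 /ess_supP|mu0 _].
  by apply: filterS => x /=; rewrite lee_fin.
exists setT; split => //; apply/eqP.
by rewrite eq_le measure_ge0 andbT leNgt.
Qed.

Section free_energy.
Variables (R : realType) (N : nat) (Omega : set 'rV[R]_N).
Hypotheses (mOmega : measurable Omega) (Omega_fin : (lebesgue_rV R N Omega < +oo)%E).
Variable J : 'rV[R]_N -> 'rV[R]_N -> R.
Hypothesis mJ : measurable_fun setT (fun z : 'rV[R]_N * 'rV[R]_N => J z.1 z.2).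
Hypothesis J_ge0 : forall x y, 0 <= J x y.

Local Notation nu := (mfrestr mOmega Omega_fin).

(** The change from [f], [th] to [Q], [P] is meant for truncations, which modify
neither [f \o w] nor [th \o w] outside of a negligible set. *)
Lemma free_energyE (f th P Q : R -> R) (mbar : R) (w : 'rV[R]_N -> R) :
  measurable_fun setT f -> measurable_fun setT th ->
  measurable_fun setT P -> measurable_fun setT Q -> measurable_fun setT w ->
  {ae nu, forall x, th (w x) = P (w x)} ->
  {ae nu, forall x, f (w x) = Q (w x)} ->
  free_energy Omega J f th mbar w =
  \int[nu]_x (P (w x) - th mbar) +
  4^-1 * interaction nu (fun z => J z.1 z.2) (Q \o w).
Proof.
move=> mf mth mP mQ mw thP fQ.
have J0 (z : 'rV[R]_N * 'rV[R]_N) : 0 <= J z.1 z.2 by [].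
have mfw := measurableT_comp mf mw; have mQw := measurableT_comp mQ mw.
have minner (F : 'rV[R]_N -> R) : measurable_fun setT F -> forall x, measurable_fun setT
    (fun y => J x y * (F x - F y) ^+ 2).
  move=> mF x; apply: measurable_funM.
    exact: (measurableT_comp mJ (measurable_pair1 x)).
  by apply: measurable_funX; apply: measurable_funB.
rewrite /free_energy; congr (_ + _ * _).
  rewrite (Rintegral_mrestr _ mOmega); last first.
    by apply: measurable_funB => //; exact: measurableT_comp mth mw.
  apply: ae_eq_Rintegral.
  - by apply: measurable_funB => //; exact: measurableT_comp mth mw.
  - by apply: measurable_funB => //; exact: measurableT_comp mP mw.
  - by apply: filterS thP => x /= ->.
have innerE x : \int[lebesgue_rV R N]_(y in Omega) (J x y * (f (w x) - f (w y)) ^+ 2)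
    = \int[nu]_y (J x y * ((f \o w) x - (f \o w) y) ^+ 2).
  by rewrite (Rintegral_mrestr _ mOmega)//; exact: minner mfw x.
under eq_Rintegral do rewrite innerE.
rewrite (Rintegral_mrestr _ mOmega); last exact: (measurable_inner _ mJ J0 mfw).
rewrite /interaction; apply: ae_eq_Rintegral.
- exact: (measurable_inner _ mJ J0 mfw).
- exact: (measurable_inner _ mJ J0 mQw).
apply: filterS (fQ) => x fQx; apply: ae_eq_Rintegral.
- exact: minner mfw x.
- exact: minner mQw x.
- by apply: filterS fQ => y fQy; rewrite /= fQx fQy.
Qed.

End free_energy.

(** * Continuity of the functional *)

Lemma continuous_clip_bounded (R : realType) (a b : R) (phi : R -> R) : a <= b ->
  continuous phi ->
  exists2 M : R, 0 <= M & forall x, `|phi (clip a b x)| <= M.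
Proof.
move=> ab cphi.
have wphi : {within `[a, b], continuous (fun x => `|phi x|)}.
  apply: continuous_subspaceT => x.
  exact: (@continuous_comp _ _ _ phi Num.norm _ (cphi x) (@norm_continuous _ _ _)).
have [c _ cM] := EVT_max ab wphi.
by exists `|phi c| => // x; apply: cM; exact: clip_itv.
Qed.

Lemma measurable_theta (R : realType) (rho h beta : R) (f finv ginv th : R -> R) :
  continuous th ->
  (forall m, m \in `[- rho, rho] -> theta rho h beta f finv ginv m = th m) ->
  measurable_fun setT (theta rho h beta f finv ginv).
Proof.
move=> cth thE.
have -> : theta rho h beta f finv ginv = th \_ `[- rho, rho].
  apply/funext => m; rewrite patchE; case: ifPn => [|].
    by rewrite inE/= => /thE.
  by rewrite notin_setE/= => /negP/negbTE mr; rewrite /theta mr.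
apply/(measurable_restrictT _ _).1 => //; apply: measurable_funTS.
exact: continuous_measurable_fun.
Qed.

Theorem theorem6p1 (R : realType) (N : nat) (hN : (0 < N)%N)
    (Omega : set 'rV[R]_N) (Omega_open : open Omega)
    (Omega_connected : connected Omega) (Omega_nonempty : Omega !=set0)
    (Omega_bounded : bounded_set Omega) (Omega_smooth : smooth_boundary Omega)
    (h beta : R) (h_ge0 : 0 <= h) (beta_gt0 : 0 < beta)
    (J : 'rV[R]_N -> 'rV[R]_N -> R)
    (J_ge0 : forall x y, 0 <= J x y)
    (J_sym : forall x y, J x y = J y x)
    (J_C1 : Ck 1 (fun z : 'rV[R]_N * 'rV[R]_N => J z.1 z.2))
    (J_int2 : forall x, (\int[lebesgue_rV R N]_y (J x y)%:E = 1)%E)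
    (J_int1 : forall y, (\int[lebesgue_rV R N]_x (J x y)%:E = 1)%E)
    (p : \bar R) (p_ge1 : (1 <= p)%E)
    (f g : R -> R)
    (f_lip : locally_lipschitz f) (g_lip : locally_lipschitz g)
    (k1 k2 c1 c2 : R)
    (k1_ge0 : 0 <= k1) (k2_ge0 : 0 <= k2) (c1_ge0 : 0 <= c1) (c2_ge0 : 0 <= c2)
    (g_growth : forall x, `|g x| <= k1 * `|x| + k2)
    (f_growth : forall x, `|f x| <= c1 * `|x| + c2)
    (k1_beta_c1 : k1 * beta * c1 < 1)
    (g_C1 : Ck 1 g)
    (k3 k4 : R) (k3_ge0 : 0 <= k3) (k4_ge0 : 0 <= k4)
    (g'_growth : forall x, `|(g^`())%classic x| <= k3 * `|x| + k4)
    (rho : R) (rho_gt0 : 0 < rho)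
    (g_bound : forall x, `|g x| < rho)
    (finv ginv : R -> R)
    (finvK : {in `[- rho, rho], cancel f finv})
    (gK : cancel g ginv)
    (ginvK : {in `]- rho, rho[, cancel ginv g})
    (ginv_continuous : {in `]- rho, rho[, continuous ginv})
    (theta_wd : theta_well_defined rho f finv ginv)
    (mbar : R) (mbar_in : mbar \in `]- rho, rho[)
    (mbar_min : forall m, m \in `[- rho, rho] ->
       theta rho h beta f finv ginv mbar <= theta rho h beta f finv ginv m) :
  let mu := lebesgue_on Omega_open in
  let F (u : Lp Omega_open p_ge1) :=
    free_energy Omega J f (theta rho h beta f finv ginv) mbar u in
  let D := [set u : Lp Omega_open p_ge1 |
    ('N[mu]_+oo%E [EFin \o u] <= rho%:E)%E] in
  forall u, D u -> forall e : R, 0 < e ->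
  exists2 d : R, 0 < d & forall v, D v ->
    ('N[mu]_p [EFin \o (v \- u)%R] < d%:E)%E -> `|F v - F u| < e.
Proof.
have rr : - rho <= rho by lra.
have cf : continuous f by exact: locally_lipschitz_continuous.
have [th cth thE] := theta_continuous h beta rho_gt0 cf theta_wd.
have mth := measurable_theta cth thE.
have cJ : continuous (fun z : 'rV[R]_N * 'rV[R]_N => J z.1 z.2).
  by move=> z; apply: differentiable_continuous; case: J_C1.
have mJ := continuous_measurable_prod_rV cJ.
have Omega_fin := lebesgue_rV_bounded_lty (open_measurable_mx Omega_open) Omega_bounded.
pose nu : {finite_measure set 'rV[R]_N -> \bar R} :=
  mfrestr (open_measurable_mx Omega_open) Omega_fin.
have nuT : (nu setT < +oo)%E by rewrite -ge0_fin_numE// fin_num_measure.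
have J0 (z : 'rV[R]_N * 'rV[R]_N) : 0 <= J z.1 z.2 by [].
have Jnu2 x : (\int[nu]_y (J x y)%:E <= 1)%E.
  have mJx : measurable_fun setT (EFin \o J x).
    by apply/measurable_EFinP; exact: (measurableT_comp mJ (measurable_pair1 x)).
  rewrite -(integral_mrestr (lebesgue_rV R N) (open_measurable_mx Omega_open) mJx).
  rewrite -(J_int2 x).
  apply: ge0_subset_integral => //; first exact: open_measurable_mx.
  by move=> y _; rewrite lee_fin.
have Jnu1 y : (\int[nu]_x (J x y)%:E <= 1)%E.
  by under eq_integral do rewrite J_sym.
pose thc := th \o clip (- rho) rho; pose fc := f \o clip (- rho) rho.
have cthc : continuous thc.
  by move=> x; apply: continuous_comp; [exact: continuous_clip|exact: cth].
have cfc : continuous fc.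
  by move=> x; apply: continuous_comp; [exact: continuous_clip|exact: cf].
have mf := continuous_measurable_fun cf.
have mthc := continuous_measurable_fun cthc.
have mfc := continuous_measurable_fun cfc.
move=> mu F D.
have mLp (w : Lp Omega_open p_ge1) : measurable_fun setT (w : 'rV[R]_N -> R).
  by rewrite /Lp_fun /aqEqMfun_to_fun;
    exact (@measurable_funPT _ _ _ _ (repr (LebesgueSpace.sort w))).
have FE w : D w -> F w = \int[nu]_x (thc (w x) - theta rho h beta f finv ginv mbar) +
    4^-1 * interaction nu (fun z => J z.1 z.2) (fc \o w).
  move=> Dw; have wr : {ae nu, forall x, w x \in `[- rho, rho]}.
    by apply: filterS (ae_le_of_Lnormy_le Dw) => x; rewrite in_itv/= ler_norml.
  apply: free_energyE => //.
  - by apply: filterS wr => x wx; rewrite thE// /thc/= clip_id.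
  - by apply: filterS wr => x wx; rewrite /fc/= clip_id.
have [M M0 fM] := continuous_clip_bounded rr cf.
have [Mth _ thM] := continuous_clip_bounded rr cth.
move=> u Du e e0.
have [d1 d10 nem1] := nemytskii_continuous nuT rr p_ge1 cth (divr_gt0 e0 (ltr0n _ 2)).
(* The interaction term has weight 1/4 and Lipschitz constant [8 M]; a distance
   [e / 4 / (M + 1)] makes its variation less than [e / 2]. *)
have e2 : 0 < e / 4 / (M + 1) by rewrite !divr_gt0// ltr_wpDl.
have [d2 d20 nem2] := nemytskii_continuous nuT rr p_ge1 cf e2.
exists (Num.min d1 d2) => [|v Dv uv]; first by rewrite lt_min d10.
have uv1 : ('N[nu]_p [EFin \o (v \- u)%R] < d1%:E)%E.
  by apply: (lt_le_trans uv); rewrite lee_fin ge_min lexx.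
have uv2 : ('N[nu]_p [EFin \o (v \- u)%R] < d2%:E)%E.
  by apply: (lt_le_trans uv); rewrite lee_fin ge_min lexx orbT.
have {nem1} := nem1 _ _ (mLp u) (mLp v) uv1.
have {nem2} := nem2 _ _ (mLp u) (mLp v) uv2.
move=> fuv thuv.
pose c := theta rho h beta f finv ginv mbar.
have iA w : measurable_fun setT w ->
    nu.-integrable setT (EFin \o (fun x => thc (w x) - c)).
  move=> mw; apply: measurable_bounded_integrable => //.
    by apply: measurable_funB => //; exact: measurableT_comp mthc mw.
  exists (Mth + `|c|); split; [exact: num_real|move=> K MK x _ /=].
  by apply: le_trans (ltW MK); apply: (le_trans (ler_normB _ _));
    rewrite lerD2r; exact: thM.
have dA : `|\int[nu]_x (thc (v x) - c) - \int[nu]_x (thc (u x) - c)| < e / 2.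
  rewrite -lte_fin.
  apply: le_lt_trans (le_dist_Rintegral (iA _ (mLp v)) (iA _ (mLp u))) _.
  by under eq_integral do rewrite opprB subrKA.
have dI : `|interaction nu (fun z => J z.1 z.2) (fc \o v) -
            interaction nu (fun z => J z.1 z.2) (fc \o u)| <= 2 * e.
  rewrite -lee_fin.
  apply: le_trans (interaction_lipschitz mJ J0 Jnu2 Jnu1 M0
    (measurableT_comp mfc (mLp v)) (measurableT_comp mfc (mLp u)) _ _) _.
  - by move=> x; exact: fM.
  - by move=> x; exact: fM.
  apply: (@le_trans _ _ ((8 * M)%:E * (e / 4 / (M + 1))%:E)%E).
    by apply: lee_wpmul2l; [rewrite lee_fin mulr_ge0|exact: ltW].
  rewrite -EFinM lee_fin mulrA ler_pdivrMr ?ltr_wpDl//; nra.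
rewrite (FE v)// (FE u)// -/c.
move: dA dI; rewrite !ltr_norml !ler_norml => /andP[? ?] /andP[? ?].
by apply/andP; split; lra.
Qed.
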